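(* Let $r\ge1$, $\Omega=\{1,\dots,r\}$, let $n_1,\dots,n_r\ge2$ be pairwise coprime integers and $m_1,\dots,m_r\in\mathbb{Z}$, and assume that for every nonempty $I\subseteq\Omega$ the integers $[\mathbf n(I)]:=\prod_{i\in I}n_i$ and $|\mathbf m(I)|:=\sum_{i\in I}m_i$ are coprime. Then $$Z_q(s;\sigma_{n_1,m_1},\dots,\sigma_{n_r,m_r})=\prod_{\emptyset\neq I\subseteq J\subseteq\Omega}\zeta\big(s,\sigma_{[\mathbf n(I)],|\mathbf m(J)|};\beta_{[\mathbf n(I)],q}\big)^{(-1)^{\#J-\#I}}.$$
   Context: $\sigma_{n,m}:=(\sigma_1\cdots\sigma_{n-1})^m\in\mathrm{B}_n$ (braid group with standard generators $\sigma_i$). The Burau representation $\beta_{n,q}$ is given by $\beta_{n,q}(\sigma_i)=I_{i-1}\oplus\begin{pmatrix}1-q&1\\ q&0\end{pmatrix}\oplus I_{n-i-1}$ over $\mathbb{Z}[q^{\pm1}]$, and $\zeta(s,\sigma;\beta_{n,q}):=\det(I_n-\beta_{n,q}(\sigma)s)^{-1}$. For $\tau_k\in\mathrm{B}_{n_k}$ ($1\le k\le r$), $Z_q(s;\tau_1,\dots,\tau_r):=\det\big(I_{n_1\cdots n_r}-\beta_{n_1,q}(\tau_1)\otimes\cdots\otimes\beta_{n_r,q}(\tau_r)\,s\big)^{-1}$, with $\otimes$ the Kronecker tensor product of matrices. *)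

(* Defs.v *)
From HB Require Import structures.
From mathcomp Require Import all_boot all_order all_algebra.
Set Implicit Arguments. Unset Strict Implicit. Unset Printing Implicit Defensive.
Import Order.TTheory GRing.Theory Num.Theory.
Local Open Scope ring_scope.

(* Ground field: K = Frac(Z[q][s]).  Z[q^{+-1}][s] embeds in K, with
   q := the inner polynomial variable, s := the outer polynomial variable. *)
Definition K : fieldType := {fraction {poly {poly int}}}.
Definition qK : K := tofrac (('X : {poly int})%:P).
Definition sK : K := tofrac ('X : {poly {poly int}}).

(* Burau matrix of the standard generator sigma_(k+1) in B_n (k is 0-based,
   meaningful for k < n-1):  I_k (+) [[1-q, 1], [q, 0]] (+) I_(n-k-2). *)
Definition burau_gen (n k : nat) : 'M[K]_n :=
  \matrix_(a < n, b < n)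
    if (a == k :> nat) && (b == k :> nat) then 1 - qK
    else if (a == k :> nat) && (b == k.+1 :> nat) then 1
    else if (a == k.+1 :> nat) && (b == k :> nat) then qK
    else if (a == k.+1 :> nat) && (b == k.+1 :> nat) then 0
    else (a == b)%:R.

Definition burau_delta (n : nat) : 'M[K]_n :=
  foldr (fun k A => burau_gen n k *m A) 1%:M (iota 0 n.-1).

Definition mxpowz (n : nat) (A : 'M[K]_n) (m : int) : 'M[K]_n :=
  match m with
  | Posz k => iter k (mulmx A) 1%:M
  | Negz k => iter k.+1 (mulmx (invmx A)) 1%:M
  end.

(* beta_{n,q}(sigma_{n,m}) = beta_{n,q}((sigma_1 ... sigma_{n-1})^m). *)
Definition burau_snm (n : nat) (m : int) : 'M[K]_n := mxpowz (burau_delta n) m.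

Definition zeta_snm (n : nat) (m : int) : K :=
  (\det (1%:M - sK *: burau_snm n m))^-1.

(* Kronecker product of matrices, row index a*p+b <-> (a,b). *)
Lemma kron_fst_proof (m p : nat) (i : 'I_(m * p)) : (i %/ p < m)%N.
Proof.
move: (nat_of_ord i) (ltn_ord i) => k; clear i; case: p => [|p]; first by rewrite muln0.
by move=> H; rewrite ltn_divLR.
Qed.
Lemma kron_snd_proof (m p : nat) (i : 'I_(m * p)) : (i %% p < p)%N.
Proof.
move: (nat_of_ord i) (ltn_ord i) => k; clear i; case: p => [|p]; first by rewrite muln0.
by rewrite ltn_mod.
Qed.
Definition kron_fst m p (i : 'I_(m * p)) : 'I_m := Ordinal (kron_fst_proof i).
Definition kron_snd m p (i : 'I_(m * p)) : 'I_p := Ordinal (kron_snd_proof i).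

Definition kronmx (m p : nat) (A : 'M[K]_m) (B : 'M[K]_p) : 'M[K]_(m * p) :=
  \matrix_(i, j) (A (kron_fst i) (kron_fst j) * B (kron_snd i) (kron_snd j)).

Fixpoint dims (l : seq (nat * int)) : nat :=
  if l is (n, _) :: t then (n * dims t)%N else 1%N.

Fixpoint kron_burau (l : seq (nat * int)) : 'M[K]_(dims l) :=
  match l return 'M[K]_(dims l) with
  | [::] => 1%:M
  | (n, m) :: t => kronmx (burau_snm n m) (kron_burau t)
  end.

Definition Zq (l : seq (nat * int)) : K :=
  (\det (1%:M - sK *: kron_burau l))^-1.

(* Main.v *)
(* Write delta_n for the Burau matrix of sigma_1 ... sigma_(n-1). It equals
   q P + (1 - q) e_0 1^T, where P is the cyclic shift of the n coordinates, so its
   eigenvalues are 1 and q w^a for 0 < a < n, w being a primitive n-th root of 1.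
   Compared with the family q w^a, 0 <= a < n, only the eigenvalue q is replaced
   by 1. Hence each tensor factor turns a product of terms 1 - (x q^k)^N into three
   such products: factor 1 contributes x, the full family contributes
   1 - (x q^(k+m))^(N n) because N and n are coprime, and the term at x q^m is
   divided out. Iterating gives
     Z_q(x)^-1 = prod_(I <= J) (1 - (x q^|m(J)|)^[n(I)])^((-1)^(#J - #I)),
   with I = set0 allowed. For one factor this reads
     zeta(x)^-1 = (1 - x) (1 - (x q^m)^n) / (1 - x q^m),
   and the extra ratios (1 - x) / (1 - x q^|m(J)|), as well as the terms with
   I = set0, disappear because alternating sums over subsets vanish.
   All this takes place in an algebraic closure of the ground field, to have the
   roots of unity at hand. *)
Require Import Defs.
From HB Require Import structures.
From mathcomp Require Import all_boot all_order all_algebra.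
From mathcomp Require Import generic_quotient cyclic separable closed_field cyclotomic ring.
Import Order.TTheory GRing.Theory Num.Theory.
Local Open Scope ring_scope.

Set Implicit Arguments. Unset Strict Implicit. Unset Printing Implicit Defensive.

(** * Primitive roots of unity over an extension of the ground field *)

(** Serves to make [K] countable, as the construction of an algebraic closure requires. *)
Lemma fraction_pcancel (R : idomainType) :
  pcancel (fun x : {fraction R} => val (repr x))
          (fun p => omap (\pi_{fraction R})%qT (insub p)).
Proof. by move=> x /=; rewrite valK /= reprK. Qed.

(** [X^N - 1] is separable, hence has [N] distinct roots, and [N] distinct N-th roots of unity in a
    field include a primitive one. *)
Lemma closed_field_prim_root (F : closedFieldType) (N : nat) :
  N%:R != 0 :> F -> exists z : F, N.-primitive_root z.
Proof.
move=> nzN; have N0 : (0 < N)%N by case: N nzN => //; rewrite eqxx.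
have [rs Drs] := closed_field_poly_normal ('X^N - 1 : {poly F}).
rewrite lead_coefXnsubC // scale1r in Drs.
have Urs : uniq rs.
  by rewrite -separable_prod_XsubC -Drs; apply: separable_Xn_sub_1.
have sz : size rs = N.
  by apply/eq_add_S; rewrite -(size_prod_XsubC rs id) -Drs size_XnsubC.
suff /hasP[z _ zP] : has N.-primitive_root rs by exists z.
apply: has_prim_root => //; last by rewrite sz.
by apply/allP=> x; rewrite -root_prod_XsubC -Drs.
Qed.

Lemma K_natr_eq0 (N : nat) : (N%:R == 0 :> K) = (N == 0)%N.
Proof.
rewrite -(rmorph_nat (@tofrac {poly {poly int}})) tofrac_eq0.
by rewrite -!(rmorph_nat polyC) !polyC_eq0 pnatr_eq0.
Qed.

Lemma K_prim_root_extension (N : nat) : (0 < N)%N ->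
  exists (L : fieldType) (f : {rmorphism K -> L}) (z : L), N.-primitive_root z.
Proof.
move=> N0.
pose cK := PCanIsCountable (@fraction_pcancel {poly {poly int}}).
pose F : countFieldType := HB.pack (Choice.sort K) K cK.
have [L [f _]] := countable_algebraic_closure F.
have [|z zP] := @closed_field_prim_root L N.
  by rewrite -(rmorph_nat (f : {rmorphism K -> L})) fmorph_eq0 K_natr_eq0 -lt0n.
by exists L, f, z.
Qed.

(** * Independence of [s] and [q] *)

(** At [s = 0] the left side vanishes and the right side does not. *)
Lemma sK_expn_neq_qK_expn (i j N : nat) : (0 < N)%N ->
  (sK ^+ N * qK ^+ i != qK ^+ j).
Proof.
move=> N0; rewrite /sK /qK -!rmorphXn -rmorphM tofrac_eq /=.
apply/eqP => /(congr1 (horner_eval 0)); rewrite !rmorphM !rmorphXn /=.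
rewrite /horner_eval hornerX !hornerC expr0n eqn0Ngt N0 mul0r => /esym/eqP.
by rewrite expf_eq0 polyX_eq0 andbF.
Qed.

Lemma qK_expn_neq1 N : (0 < N)%N -> qK ^+ N != 1.
Proof.
move=> N0; rewrite /qK -rmorphXn -(rmorph1 (@tofrac _)) tofrac_eq /=.
(* The first evaluation sets [s = 0], the second [q = 0]. *)
apply/eqP => /(congr1 (horner_eval 0)); rewrite !rmorphXn rmorph1 /=.
rewrite /horner_eval hornerC => /(congr1 (horner_eval 0)); rewrite !rmorphXn rmorph1 /=.
by rewrite /horner_eval hornerX expr0n eqn0Ngt N0 => /eqP; rewrite eq_sym oner_eq0.
Qed.

Lemma qK_neq0 : qK != 0.
Proof. by rewrite /qK tofrac_eq0 polyC_eq0 polyX_eq0. Qed.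

Lemma sK_mul_qK_expn_neq1 (k : int) N : (0 < N)%N -> (sK * qK ^ k) ^+ N != 1.
Proof.
move=> N0; case: k => k.
  by rewrite exprMn -[_ ^ k]/(qK ^+ k) -exprM -(expr0 qK) sK_expn_neq_qK_expn.
rewrite NegzE -exprnN exprMn exprVn -exprM.
apply: contra (sK_expn_neq_qK_expn 0 (k.+1 * N) N0) => /eqP e.
by rewrite expr0 mulr1 -[X in _ == X]mul1r -e divfK // expf_neq0 ?qK_neq0.
Qed.

(** * The Burau matrix of [sigma_1 ... sigma_(n-1)] *)

Lemma sum_mul_eq_natr (R : pzRingType) (n k : nat) (W : nat -> R) : (k < n)%N ->
  \sum_(a < n) W a * (a == k :> nat)%:R = W k.
Proof.
move=> kn; rewrite (bigD1 (Ordinal kn)) //= eqxx mulr1 big1 ?addr0 // => a ak.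
by rewrite (negPf (_ : a != k :> nat)) ?mulr0 //; apply: contra ak => /eqP/val_inj/eqP.
Qed.

Lemma row_mul_burau_gen (n k : nat) (W : nat -> K) : (k.+1 < n)%N ->
  (\row_(a < n) W a) *m burau_gen n k =
  \row_(b < n) (if b == k :> nat then (1 - qK) * W k + qK * W k.+1
                else if b == k.+1 :> nat then W k else W b).
Proof.
move=> kn; apply/rowP => b; rewrite !mxE.
have [bk|bk] := eqVneq (b : nat) k.
  rewrite -(sum_mul_eq_natr W (ltnW kn)) -(sum_mul_eq_natr W kn) !mulr_sumr.
  rewrite -big_split; apply: eq_bigr => a _ /=; rewrite !mxE bk eqxx andbT.
  have [->|ak] /= := eqVneq (a : nat) k.
    by rewrite (ltn_eqF (ltnSn k)) mulr0 mulr0 addr0 mulr1 mulrC.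
  rewrite mulr0 mulr0 add0r (ltn_eqF (ltnSn k)) !andbF andbT.
  have [_|ak1] := eqVneq (a : nat) k.+1; first by rewrite mulr1 mulrC.
  by rewrite -(inj_eq val_inj) /= bk (negPf ak) !mulr0.
have [bk1|bk1] := eqVneq (b : nat) k.+1.
  rewrite -(sum_mul_eq_natr W (ltnW kn)); apply: eq_bigr => a _ /=.
  rewrite !mxE bk1 eqxx !andbT (gtn_eqF (ltnSn k)) !andbF -(inj_eq val_inj) /= bk1.
  by case: (a == k :> nat) => //; case: (a == k.+1 :> nat).
rewrite -(sum_mul_eq_natr W (ltn_ord b)); apply: eq_bigr => a _ /=.
by rewrite !mxE (negPf bk) (negPf bk1) !andbF -(inj_eq val_inj).
Qed.

(** Each generator mixes two neighbouring entries and passes [W k] one place to the right, so [W k]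
    travels to the last column. The start [k] and the row [W] are general because both change in the
    induction. *)
Lemma row_mul_burau_gens (n l k : nat) (W : nat -> K) : (k + l).+1 = n ->
  (\row_(a < n) W a) *m foldr (fun k A => burau_gen n k *m A) 1%:M (iota k l) =
  \row_(b < n) (if (b < k)%N then W b
                else if (b.+1 < n)%N then (1 - qK) * W k + qK * W b.+1 else W k).
Proof.
elim: l k W => [|l IH] k W En /=.
  rewrite mulmx1; apply/rowP => b; rewrite !mxE; rewrite addn0 in En.
  have := ltn_ord b; rewrite -[X in (_ < X)%N]En ltnS leq_eqVlt => /predU1P[->|->] //.
  by rewrite -En !ltnn.
have kn : (k.+1 < n)%N by rewrite -En addnS !ltnS leq_addr.
pose W' b := if b == k then (1 - qK) * W k + qK * W k.+1
             else if b == k.+1 then W k else W b.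
rewrite mulmxA row_mul_burau_gen // (IH _ W') ?addSnnS // {}/W'.
apply/rowP => b; rewrite !mxE ltnS (gtn_eqF (ltnSn k)) eqxx.
case: (ltngtP b k) => [bk|bk|->].
- by rewrite ltn_eqF // ltnW.
- by rewrite !gtn_eqF // ltnW.
- by rewrite kn.
Qed.

Lemma burau_deltaE (n : nat) :
  burau_delta n.+1 = \matrix_(a, b)
    (qK * (a == (b.+1 %% n.+1)%N :> nat)%:R + (1 - qK) * (a == 0 :> nat)%:R).
Proof.
apply/row_matrixP => a.
rewrite rowE (_ : delta_mx 0 a = \row_(c < n.+1) (c == a :> nat)%:R); last first.
  by apply/rowP => c; rewrite !mxE.
rewrite (row_mul_burau_gens (fun c => (c == a)%:R)) //.
apply/rowP => b; rewrite !mxE ltn0 !(eq_sym (a : nat)).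
have [bn|] := ltnP; first by rewrite modn_small // addrC.
(* In the last column the index wraps to 0: both terms lie in row 0 and [q + (1 - q) = 1]. *)
rewrite leqNgt ltnS => bn; have -> : b.+1 = n.+1.
  by apply/eqP; rewrite eqn_leq ltn_ord ltnNge.
by rewrite modnn -mulrDl addrC subrK mul1r.
Qed.

(** * Diagonalization, powers and inverses *)

(** The rows of [V] are left eigenvectors; the same [V] then serves all integer powers of [A]. *)
Definition diagonalizes (F : fieldType) n (A : 'M[F]_n) (d : 'I_n -> F) : Prop :=
  exists2 V, V \in unitmx & V *m A = diag_mx (\row_i d i) *m V.

Lemma diagonalizes_det1B (F : fieldType) n (A : 'M[F]_n) d x : diagonalizes A d ->
  \det (1%:M - x *: A) = \prod_i (1 - x * d i).
Proof.
case=> V Vu VA; have dV : \det V != 0 by rewrite -unitfE -unitmxE.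
apply: (mulfI dV); rewrite -det_mulmx mulmxBr mulmx1 -scalemxAr VA scalemxAl.
rewrite -{1}[V]mul1mx -mulmxBl det_mulmx mulrC; congr (_ * _).
have -> : 1%:M - x *: diag_mx (\row_i d i) = diag_mx (\row_i (1 - x * d i)).
  apply/matrixP => i j; rewrite !mxE; case: eqP => _; rewrite ?mulr1n //.
  by rewrite !mulr0n mulr0 subr0.
by rewrite det_diag; apply: eq_bigr => i _; rewrite mxE.
Qed.

Lemma diagonalizes_mulmx (F : fieldType) n (V A B : 'M[F]_n) (d e : 'I_n -> F) :
  V *m A = diag_mx (\row_i d i) *m V -> V *m B = diag_mx (\row_i e i) *m V ->
  V *m (A *m B) = diag_mx (\row_i (d i * e i)) *m V.
Proof.
move=> VA VB; rewrite mulmxA VA -mulmxA VB mulmxA mulmx_diag; congr (diag_mx _ *m _).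
by apply/rowP => i; rewrite !mxE.
Qed.

Lemma diagonalizes_iter (F : fieldType) n (V A : 'M[F]_n) (d : 'I_n -> F) k :
  V *m A = diag_mx (\row_i d i) *m V ->
  V *m iter k (mulmx A) 1%:M = diag_mx (\row_i (d i ^+ k)) *m V.
Proof.
move=> VA; elim: k => [|k IH] /=.
  rewrite mulmx1 (_ : \row_i _ = const_mx 1) ?diag_const_mx ?mul1mx //.
  by apply/rowP => i; rewrite !mxE expr0.
by rewrite (diagonalizes_mulmx VA IH); under eq_mx do rewrite -exprS.
Qed.

Lemma diagonalizes_inv (F : fieldType) n (V A : 'M[F]_n) (d : 'I_n -> F) :
  V \in unitmx -> (forall i, d i != 0) ->
  V *m A = diag_mx (\row_i d i) *m V ->
  V *m invmx A = diag_mx (\row_i (d i)^-1) *m V.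
Proof.
move=> Vu d0 VA; set D := diag_mx (\row_i (d i)^-1).
have DV : D *m diag_mx (\row_i d i) = 1%:M.
  rewrite mulmx_diag -diag_const_mx; congr diag_mx.
  by apply/rowP => i; rewrite !mxE mulVf.
have Au : A \in unitmx.
  have : V *m A \in unitmx by rewrite VA unitmx_mul Vu (mulmx1_unit DV).2.
  by rewrite unitmx_mul => /andP[].
have := congr1 (fun M => D *m M *m invmx A) VA.
by rewrite !mulmxA DV mul1mx mulmxK.
Qed.

Lemma map_mx_iter_mulmx (aF rF : fieldType) (f : {rmorphism aF -> rF}) n
    (A : 'M[aF]_n) k :
  map_mx f (iter k (mulmx A) 1%:M) = iter k (mulmx (map_mx f A)) 1%:M.
Proof. by elim: k => [|k IH] /=; rewrite ?map_mx1 // map_mxM IH. Qed.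

Lemma diagonalizes_mxpowz (L : fieldType) (f : {rmorphism K -> L}) n (A : 'M[K]_n)
    d (m : int) : (forall i, d i != 0) -> diagonalizes (map_mx f A) d ->
  diagonalizes (map_mx f (mxpowz A m)) (fun i => d i ^ m).
Proof.
move=> d0 [V Vu VA]; exists V => //; case: m => k.
  by rewrite map_mx_iter_mulmx; apply: diagonalizes_iter.
rewrite map_mx_iter_mulmx map_invmx.
rewrite (diagonalizes_iter _ (diagonalizes_inv Vu d0 VA)).
by under eq_mx do rewrite exprVn.
Qed.

(** * Kronecker products *)

(** The formula of [kronmx], which is tied to [K], over any ring: the eigenvectors live over an
    extension. *)
Definition tensormx (R : pzRingType) (m p : nat) (A : 'M[R]_m) (B : 'M[R]_p) :
    'M[R]_(m * p) :=
  \matrix_(i, j) (A (kron_fst i) (kron_fst j) * B (kron_snd i) (kron_snd j)).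

Lemma kron_pair_proof (m p : nat) (ij : 'I_m * 'I_p) : (ij.1 * p + ij.2 < m * p)%N.
Proof.
apply: (@leq_trans (ij.1.+1 * p)); last by rewrite leq_mul2r ltn_ord orbT.
by rewrite mulSn addnC ltn_add2r.
Qed.

Definition kron_pair (m p : nat) (ij : 'I_m * 'I_p) : 'I_(m * p) :=
  Ordinal (kron_pair_proof ij).

Lemma kron_pairK (m p : nat) :
  cancel (@kron_pair m p) (fun i => (kron_fst i, kron_snd i)).
Proof.
case=> i j; have p0 : (0 < p)%N by apply: leq_ltn_trans (ltn_ord j).
congr (_, _); apply: val_inj; rewrite /= ?modnMDl ?modn_small //.
by rewrite divnMDl // divn_small ?addn0.
Qed.

Lemma kron_fst_sndK (m p : nat) :
  cancel (fun i => (kron_fst i, kron_snd i)) (@kron_pair m p).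
Proof. by move=> i; apply: val_inj; rewrite /= -divn_eq. Qed.

Lemma big_kron (R : Type) (idx : R) (op : Monoid.com_law idx) m p
    (F : 'I_m -> 'I_p -> R) :
  \big[op/idx]_(i < m * p) F (kron_fst i) (kron_snd i) =
  \big[op/idx]_(a < m) \big[op/idx]_(b < p) F a b.
Proof.
rewrite pair_big /= (reindex (fun i : 'I_(m * p) => (kron_fst i, kron_snd i))) //=.
by exists (@kron_pair m p) => i _; [apply: kron_fst_sndK | apply: kron_pairK].
Qed.

Lemma tensormx_mul (R : comPzRingType) m p (A C : 'M[R]_m) (B D : 'M[R]_p) :
  tensormx A B *m tensormx C D = tensormx (A *m C) (B *m D).
Proof.
apply/matrixP => i j; rewrite !mxE big_distrlr /= -big_kron.
by apply: eq_bigr => k _; rewrite !mxE mulrACA.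
Qed.

Lemma tensormx_diag (R : pzRingType) m p (d : 'I_m -> R) (e : 'I_p -> R) :
  tensormx (diag_mx (\row_i d i)) (diag_mx (\row_i e i)) =
  diag_mx (\row_i (d (kron_fst i) * e (kron_snd i))).
Proof.
apply/matrixP => i j; rewrite !mxE.
have -> : (i == j) = (kron_fst i == kron_fst j) && (kron_snd i == kron_snd j).
  by rewrite -(can_eq (@kron_fst_sndK m p)).
by case: eqP; case: eqP => _ _; rewrite /= ?mulr1n ?mulr0n ?mulr0 ?mul0r.
Qed.

Lemma tensormx1 (R : pzRingType) m p :
  tensormx 1%:M 1%:M = 1%:M :> 'M[R]_(m * p).
Proof.
have id1 n : 1%:M = diag_mx (\row_i 1) :> 'M[R]_n.
  by rewrite -diag_const_mx; congr diag_mx; apply/rowP => i; rewrite !mxE.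
by rewrite !id1 tensormx_diag; under eq_mx do rewrite mulr1.
Qed.

(** By the mixed-product rule, the Kronecker product of the eigenvector matrices works, and its
    inverse is that of their inverses. *)
Lemma diagonalizes_tensormx (F : fieldType) m p (A : 'M[F]_m) (B : 'M[F]_p) d e :
  diagonalizes A d -> diagonalizes B e ->
  diagonalizes (tensormx A B) (fun i => d (kron_fst i) * e (kron_snd i)).
Proof.
move=> [V Vu VA] [W Wu WB]; exists (tensormx V W).
  apply: (@mulmx1_unit _ _ _ (tensormx (invmx V) (invmx W)) _).1.
  by rewrite tensormx_mul !mulmxV // tensormx1.
by rewrite tensormx_mul VA WB -tensormx_diag tensormx_mul.
Qed.

Lemma diagonalizes_kronmx (L : fieldType) (f : {rmorphism K -> L}) m p
    (A : 'M[K]_m) (B : 'M[K]_p) d e :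
  diagonalizes (map_mx f A) d -> diagonalizes (map_mx f B) e ->
  diagonalizes (map_mx f (kronmx A B)) (fun i => d (kron_fst i) * e (kron_snd i)).
Proof.
move=> dA dB; have -> : map_mx f (kronmx A B) = tensormx (map_mx f A) (map_mx f B).
  by apply/matrixP => i j; rewrite !mxE rmorphM.
exact: diagonalizes_tensormx.
Qed.

(** * Eigenvalues of the Burau matrix *)

Lemma prim_root_Vandermonde_unit (F : fieldType) n (z : F) :
  n.-primitive_root z -> \matrix_(i < n, j < n) z ^+ (i * j) \in unitmx.
Proof.
move=> zP; have -> : \matrix_(i < n, j < n) z ^+ (i * j) =
    Vandermonde n (\row_j z ^+ j).
  by apply/matrixP => i j; rewrite !mxE -exprM mulnC.
rewrite unitmxE det_Vandermonde unitfE; apply/prodf_neq0 => i _.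
apply/prodf_neq0 => j ij; rewrite !mxE subr_eq0 (eq_prim_root_expr zP).
by rewrite !modn_small // gtn_eqF.
Qed.

Definition burau_eig (F : fieldType) (q z : F) (i : nat) : F :=
  if i == 0 then 1 else q * z ^+ i.

Lemma diagonalizes_burau_delta (L : fieldType) (f : {rmorphism K -> L}) n (z : L) :
  n.-primitive_root z ->
  diagonalizes (map_mx f (burau_delta n)) (fun i => burau_eig (f qK) z i).
Proof.
case: n => [//|n] zP; have zn := prim_expr_order zP.
(* For [i > 0], [c i] solves the eigenvector equation [q c + (1 - q) (1 + c) = q z^i c]. *)
set q := f qK; pose c (i : nat) := if i == 0 then 0 else (1 - q) / (q * z ^+ i - 1).
have qz i : q * z ^+ i - 1 != 0.
  rewrite subr_eq0; apply: contra_neq (qK_expn_neq1 (ltn0Sn n)) => e.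
  have zi : (z ^+ i) ^+ n.+1 = 1 by rewrite exprAC zn expr1n.
  apply: (fmorph_inj f); rewrite rmorph1 rmorphXn -/q -(mulr1 (q ^+ _)).
  by rewrite -zi -exprMn e expr1n.
(* The rows (z^(ij))_j of the Fourier matrix are left eigenvectors of the cyclic
   shift; the rank-one term (1 - q) e_0 1^T is absorbed by adding c_i to row i. *)
pose V := \matrix_(i < n.+1, j < n.+1) (z ^+ (i * j) + c i).
exists V.
  (* Row 0 of the Fourier matrix is constant 1, so adding [c i] to row [i] is a row operation; since
     [c 0 = 0], [U] is lower triangular with unit diagonal. *)
  pose U := \matrix_(i < n.+1, j < n.+1) ((i == j)%:R + c i * (j == 0 :> nat)%:R).
  have -> : V = U *m \matrix_(i < n.+1, j < n.+1) z ^+ (i * j).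
    apply/matrixP => i j; rewrite !mxE.
    under eq_bigr do rewrite !mxE mulrDl; rewrite big_split /=; congr (_ + _).
      rewrite (bigD1 i) //= eqxx mul1r big1 ?addr0 // => k.
      by rewrite eq_sym => /negPf ->; rewrite mul0r.
    rewrite (bigD1 ord0) //= expr0 !mulr1 big1 ?addr0 // => k k0.
    by rewrite (negPf (_ : k != 0 :> nat)) ?mulr0 ?mul0r.
  rewrite unitmx_mul prim_root_Vandermonde_unit // andbT unitmxE det_trig.
    rewrite big1 ?unitr1 // => i _; rewrite mxE eqxx /c.
    by case: eqP; rewrite ?mul0r ?mulr0 addr0.
  apply/is_trig_mxP => i j ij; rewrite mxE -(inj_eq val_inj) /= ltn_eqF //.
  by rewrite gtn_eqF ?mulr0 ?addr0 // (leq_ltn_trans _ ij).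
rewrite burau_deltaE; apply/matrixP => i b.
have -> : (diag_mx (\row_i burau_eig q z i) *m V) i b =
    burau_eig q z i * (z ^+ (i * b) + c i).
  by rewrite mul_diag_mx !mxE.
have -> : (V *m map_mx f (\matrix_(a, b) (qK * (a == (b.+1 %% n.+1)%N :> nat)%:R
      + (1 - qK) * (a == 0 :> nat)%:R))) i b =
    q * (\sum_(a < n.+1) (z ^+ (i * a) + c i) * (a == (b.+1 %% n.+1)%N :> nat)%:R) +
    (1 - q) * (\sum_(a < n.+1) (z ^+ (i * a) + c i) * (a == 0 :> nat)%:R).
  rewrite mxE !mulr_sumr -big_split; apply: eq_bigr => a _ /=.
  rewrite !mxE rmorphD !rmorphM rmorphB rmorph1 !rmorph_nat -/q mulrDr.
  by congr (_ + _); rewrite mulrCA.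
rewrite (sum_mul_eq_natr (fun a => z ^+ (i * a) + c i)) ?ltn_pmod //.
rewrite (sum_mul_eq_natr (fun a => z ^+ (i * a) + c i)) //.
have -> : z ^+ (i * (b.+1 %% n.+1)) = z ^+ i * z ^+ (i * b).
  by rewrite -(prim_expr_mod zP) modnMmr (prim_expr_mod zP) mulnS exprD.
rewrite muln0 expr0 /burau_eig /c; have [i0|i0] := eqVneq (i : nat) 0.
  by rewrite i0 !mul0n expr0 !addr0 !mulr1 addrC subrK.
apply/eqP; rewrite -subr_eq0.
have := divfK (qz i) (1 - q); set w := _ / _ => e.
set x := z ^+ i in e *; set y := z ^+ _.
have -> : q * (x * y + w) + (1 - q) * (1 + w) - q * x * (y + w) =
    (1 - q) - w * (q * x - 1) by ring.
by rewrite e subrr.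
Qed.

(** * Products over roots of unity *)

Lemma prim_root_neq0 (R : nzRingType) n (z : R) : n.-primitive_root z -> z != 0.
Proof.
move=> zP; apply: contra_eq_neq (prim_expr_order zP) => ->.
by rewrite expr0n eqn0Ngt (prim_order_gt0 zP) eq_sym oner_neq0.
Qed.

Lemma prim_rootV (F : fieldType) n (z : F) :
  n.-primitive_root z -> n.-primitive_root z^-1.
Proof.
move=> zP; have n0 := prim_order_gt0 zP.
have z0 := prim_root_neq0 zP.
have -> : z^-1 = z ^+ n.-1.
  by apply: (mulfI z0); rewrite mulfV // -exprS prednK // prim_expr_order.
by rewrite prim_root_exp_coprime // coprimePn.
Qed.

Lemma prim_root_exprz (F : fieldType) n (z : F) (m : int) :
  n.-primitive_root z -> coprime n `|m| -> n.-primitive_root (z ^ m).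
Proof.
move=> zP; rewrite coprime_sym; case: m => k cop.
  by rewrite -[_ ^ _]/(z ^+ k) prim_root_exp_coprime.
by rewrite NegzE -exprnN -exprVn prim_root_exp_coprime // prim_rootV.
Qed.

(** For nonzero [y], evaluate the factorization of [X^n - 1] at [y^-1] and multiply by [y^n]. *)
Lemma prod_1B_prim_root (F : fieldType) n (w y : F) : n.-primitive_root w ->
  \prod_(a < n) (1 - y * w ^+ a) = 1 - y ^+ n.
Proof.
move=> wP; have n0 := prim_order_gt0 wP.
have [->|y0] := eqVneq y 0.
  by rewrite expr0n eqn0Ngt n0 subr0 big1 // => a _; rewrite mul0r subr0.
have := congr1 (horner_eval y^-1) (factor_Xn_sub_1 wP).
rewrite rmorph_prod /horner_eval !hornerE big_mkord => /(congr1 ( *%R (y ^+ n))).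
rewrite mulrBr mulr1 exprVn mulfV ?expf_neq0 // => <-.
rewrite -[X in y ^+ X]card_ord -prodr_const -big_split; apply: eq_bigr => a _.
by rewrite /= /horner_eval !hornerE mulrBr mulfV.
Qed.

(** By coprimality [w^N] is again a primitive n-th root of unity. *)
Lemma prod_1B_prim_root_expn (F : fieldType) n N (w y : F) :
  n.-primitive_root w -> coprime N n ->
  \prod_(a < n) (1 - (y * w ^+ a) ^+ N) = 1 - y ^+ (n * N).
Proof.
move=> wP cop; rewrite mulnC exprM -(@prod_1B_prim_root _ _ (w ^+ N)).
  by apply: eq_bigr => a _; rewrite exprMn -!exprM mulnC.
by rewrite prim_root_exp_coprime.
Qed.

(** Only [a = 0] departs from the family [q z^a]. The function [g] is arbitrary so as to cover both
    a single factor [1 - y] and the determinant of the remaining tensor factors. *)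
Lemma prod_burau_eig (F : fieldType) n (q z x : F) (m : int) (g : F -> F) : (0 < n)%N ->
  \prod_(a < n) g (x * burau_eig q z a ^ m) * g (x * q ^ m) =
  g x * \prod_(a < n) g (x * q ^ m * (z ^ m) ^+ a).
Proof.
case: n => // n _; rewrite !big_ord_recl /burau_eig /= exp1rz expr0 !mulr1.
rewrite -mulrA [X in _ * X]mulrC; congr (_ * (_ * _)); apply: eq_bigr => a _.
by rewrite /= expfzMl mulrA -[z ^+ _]/(z ^ (Posz _)) exprzAC.
Qed.

(** * Alternating products over subsets *)

Lemma big_subset_setU1 (R : Type) (idx : R) (op : Monoid.com_law idx) (T : finType)
    (i : T) (S : {set T}) (F : {set T} -> R) : i \notin S ->
  \big[op/idx]_(J : {set T} | J \subset i |: S) F J =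
  op (\big[op/idx]_(J : {set T} | J \subset S) F J)
     (\big[op/idx]_(J : {set T} | J \subset S) F (i |: J)).
Proof.
move=> iS; rewrite (bigID (fun J : {set T} => i \notin J)) /=; congr (op _ _).
  apply: eq_bigl => J; rewrite -subDset; have [iJ|iJ] := boolP (i \in J).
    by rewrite andbF; apply/esym; apply: contraNF iS => /subsetP; apply.
  by rewrite andbT (setDidPl _) // disjoint_sym disjoints1.
rewrite (reindex_onto (fun J => i |: J) (fun J => J :\ i)) /=; last first.
  by move=> J /andP[_ /negPn iJ]; rewrite setD1K.
apply: eq_bigl => J; rewrite setU11 andbT.
apply/andP/idP => [[sJ /eqP <-]|sJ]; first by rewrite subDset.
by rewrite setUS // setU1K //; apply: contra iS; apply: subsetP sJ i.
Qed.

Definition sign_expz (F : fieldType) (x : F) (k : nat) : F := x ^ ((-1) ^+ k : int).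

Lemma sign_expzS (F : fieldType) (x : F) k : sign_expz x k.+1 = (sign_expz x k)^-1.
Proof. by rewrite /sign_expz exprS mulN1r invr_expz. Qed.

Lemma sign_expzM (F : fieldType) (x y : F) k :
  sign_expz (x * y) k = sign_expz x k * sign_expz y k.
Proof. exact: expfzMl. Qed.

Lemma sign_expz_prod (F : fieldType) I (s : seq I) (P : pred I) (G : I -> F) k :
  sign_expz (\prod_(i <- s | P i) G i) k = \prod_(i <- s | P i) sign_expz (G i) k.
Proof.
apply: (big_morph (fun x => sign_expz x k)) => [x y|]; first exact: sign_expzM.
exact: exp1rz.
Qed.

Lemma sign_expz_neq0 (F : fieldType) (x : F) k : x != 0 -> sign_expz x k != 0.
Proof. by move=> x0; rewrite /sign_expz expfz_neq0. Qed.

(** [a - b] and [a + b] have the same parity. *)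
Lemma sign_expz_sub (F : fieldType) (x : F) a b : (b <= a)%N ->
  sign_expz x (a - b) = sign_expz (sign_expz x b) a.
Proof.
by move=> ba; rewrite /sign_expz exprz_exp -exprD -signr_odd oddB // addbC -oddD signr_odd.
Qed.

(** For a fixed [i] in [S], the factors of [I] and [i |: I] cancel. *)
Lemma prod_subset_sign_expz (F : fieldType) (T : finType) (S : {set T}) (c : F) :
  S != set0 -> c != 0 -> \prod_(I : {set T} | I \subset S) sign_expz c #|I| = 1.
Proof.
move=> /set0Pn[i iS] c0; rewrite -(setD1K iS) big_subset_setU1 ?setD11 //=.
rewrite -big_split big1 // => I sI /=; rewrite cardsU1.
have -> : i \notin I.
  by apply: contraL sI => iI; apply/negP => /subsetP/(_ i iI); rewrite setD11.
by rewrite sign_expzS mulfV ?sign_expz_neq0.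
Qed.

Lemma prod_subset_sign_expz_sub (F : fieldType) (T : finType) (S : {set T}) (c : F) :
  S != set0 -> c != 0 -> \prod_(I : {set T} | I \subset S) sign_expz c (#|S| - #|I|) = 1.
Proof.
move=> S0 c0; rewrite (eq_bigr (fun I : {set T} => sign_expz (sign_expz c #|I|) #|S|)).
  by rewrite -sign_expz_prod prod_subset_sign_expz // /sign_expz exp1rz.
by move=> I sI; rewrite sign_expz_sub // subset_leq_card.
Qed.

(* Guarantees that the factors 1 - (x q^k)^N, some of which occur in denominators, do
   not vanish. *)
Definition generic (F : fieldType) (q x : F) : Prop :=
  forall (k : int) (N : nat), (0 < N)%N -> (x * q ^ k) ^+ N != 1.

Lemma generic_mul_expz (F : fieldType) (q x : F) (k : int) :
  q != 0 -> generic q x -> generic q (x * q ^ k).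
Proof. by move=> q0 gx l N N0; rewrite -mulrA -expfzDr //; apply: gx. Qed.

(** Raising a forbidden relation to the power [n] removes [w]. *)
Lemma generic_mul_unity_root (F : fieldType) (q x w : F) n : (0 < n)%N ->
  w ^+ n = 1 -> generic q x -> generic q (x * w).
Proof.
move=> n0 wn gx k N N0; have := gx k (N * n)%N; rewrite muln_gt0 N0 n0 => /(_ isT).
apply: contra_neq => e; rewrite mulrAC in e.
have := congr1 (fun y => y ^+ n) e; rewrite expr1n -exprM exprMn.
by rewrite [w ^+ (N * n)](_ : _ = 1) ?mulr1 // mulnC exprM wn expr1n.
Qed.

(** * The closed form of the determinant *)

(** The closed form of the inverse of [Z_q], with empty [I] allowed; each new tensor factor enlarges
    [S] and shifts [x]. *)
Definition tprod (F : fieldType) (q : F) (T : finType) (n : T -> nat) (m : T -> int)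
    (S : {set T}) (x : F) : F :=
  \prod_(J : {set T} | J \subset S) \prod_(I : {set T} | I \subset J)
    sign_expz (1 - (x * q ^ (\sum_(j in J) m j)) ^+ (\prod_(i in I) n i)%N) (#|J| - #|I|).

Lemma tprod_factor_neq0 (F : fieldType) (q : F) (T : finType) (n : T -> nat) (m : T -> int)
    (I J : {set T}) x : (forall i, 0 < n i)%N -> generic q x ->
  1 - (x * q ^ (\sum_(j in J) m j)) ^+ (\prod_(i in I) n i)%N != 0.
Proof.
move=> n0 gx; rewrite subr_eq0 eq_sym; apply: gx.
by apply: prodn_cond_gt0 => i _; apply: n0.
Qed.

Lemma tprod_neq0 (F : fieldType) (q : F) (T : finType) (n : T -> nat) (m : T -> int)
    (S : {set T}) x : (forall i, 0 < n i)%N -> generic q x -> tprod q n m S x != 0.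
Proof.
move=> n0 gx; apply/prodf_neq0 => J _; apply/prodf_neq0 => I _.
by apply: sign_expz_neq0; apply: tprod_factor_neq0.
Qed.

Lemma tprod_set0 (F : fieldType) (q : F) (T : finType) (n : T -> nat) (m : T -> int)
    x : tprod q n m set0 x = 1 - x.
Proof.
rewrite /tprod (big_pred1 set0) => [|J]; last by rewrite subset0.
rewrite (big_pred1 set0) => [|J]; last by rewrite subset0.
by rewrite !big_set0 subnn /sign_expz expr0z !expr1z mulr1.
Qed.

(** The same recursion as [prod_burau_eig] gives for determinants, with [g] taken to be [tprod] over
    [S]; multiplied out to avoid division. *)
Lemma tprod_setU1 (F : fieldType) (q : F) (T : finType) (n : T -> nat) (m : T -> int)
    (S : {set T}) i w x : (forall j, 0 < n j)%N ->
  q != 0 -> generic q x -> i \notin S ->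
  (forall j, j \in S -> coprime (n j) (n i)) -> (n i).-primitive_root w ->
  tprod q n m (i |: S) x * tprod q n m S (x * q ^ m i) =
  tprod q n m S x * \prod_(a < n i) tprod q n m S (x * q ^ m i * w ^+ a).
Proof.
move=> n0 q0 gx iS cop wP; rewrite {1}/tprod big_subset_setU1 //= -mulrA; congr (_ * _).
(* For i in J: the sets I without i cancel against tprod at x q^(m i), those with i
   give the product over the n i-th roots of unity. *)
rewrite exchange_big /= /tprod -big_split; apply: eq_bigr => J sJ.
have iJ : i \notin J by apply: contra iS; apply: subsetP sJ i.
rewrite exchange_big big_subset_setU1 //= mulrAC -big_split big1 ?mul1r.
  apply: eq_bigr => I sI; have iI : i \notin I by apply: contra iJ; apply: subsetP sI i.
  rewrite !cardsU1 iJ iI subSS -sign_expz_prod; congr (sign_expz _ _).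
  rewrite !big_setU1 //= expfzDr // mulrA.
  (* The product of the [n j] over [I] is coprime to [n i], so the roots of unity raise the exponent
     to that of [i |: I]. *)
  rewrite -(prod_1B_prim_root_expn _ wP); last first.
    elim/big_ind: _ => [|a b aP bP|j jI]; rewrite ?coprime1n // ?coprimeMl ?aP //.
    by apply/cop/(subsetP sJ)/(subsetP sI).
  by apply: eq_bigr => a _; rewrite mulrAC.
move=> I sI /=; rewrite cardsU1 iJ big_setU1 //= expfzDr // mulrA.
rewrite subSn ?subset_leq_card // sign_expzS mulVf // sign_expz_neq0 //
        tprod_factor_neq0 //.
exact: generic_mul_expz.
Qed.

(** * Tensor products of Burau matrices and zeta functions *)

Lemma generic_sK (L : fieldType) (f : {rmorphism K -> L}) : generic (f qK) (f sK).
Proof.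
move=> k N N0; rewrite -fmorphXz -rmorphM -rmorphXn -(rmorph1 f) (inj_eq (fmorph_inj f)).
exact: sK_mul_qK_expn_neq1.
Qed.

Lemma diagonalizes_burau_snm (L : fieldType) (f : {rmorphism K -> L}) n (m : int) (z : L) :
  n.-primitive_root z ->
  diagonalizes (map_mx f (burau_snm n m)) (fun i => burau_eig (f qK) z i ^ m).
Proof.
move=> zP; apply: diagonalizes_mxpowz; last exact: diagonalizes_burau_delta.
have z0 := prim_root_neq0 zP.
move=> i; rewrite /burau_eig; case: ifP => _; rewrite ?oner_neq0 //.
by rewrite mulf_neq0 ?expf_neq0 // fmorph_eq0 qK_neq0.
Qed.

(** Induction on the tensor factors. The product formula is kept for all generic [x], because the
    step uses it at [x], at [x q^m] and at its multiples by roots of unity. *)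
Lemma diagonalizes_kron_burau (L : fieldType) (f : {rmorphism K -> L}) (T : finType)
    (n : T -> nat) (m : T -> int) (z : T -> L) (l : seq T) :
  (forall i, (n i).-primitive_root (z i)) ->
  (forall i, coprime (n i) `|m i|) ->
  (forall i j, i != j -> coprime (n i) (n j)) ->
  uniq l ->
  exists2 d, diagonalizes (map_mx f (kron_burau [seq (n i, m i) | i <- l])) d &
    forall x, generic (f qK) x ->
      \prod_b (1 - x * d b) = tprod (f qK) n m [set:: l] x.
Proof.
move=> zP copm copn; have n0 i : (0 < n i)%N := prim_order_gt0 (zP i).
have q0 : f qK != 0 by rewrite fmorph_eq0 qK_neq0.
elim: l => [_|i l IH /= /andP[il /IH[d dP dE]]].
  exists (fun=> 1) => [|x gx].
    exists 1%:M; rewrite ?unitmx1 // mul1mx mulmx1 map_mx1 -diag_const_mx.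
    by congr diag_mx; apply/rowP => j; rewrite !mxE.
  by rewrite big_ord1 mulr1 set_nil tprod_set0.
exists (fun b => burau_eig (f qK) (z i) (kron_fst b) ^ m i * d (kron_snd b)).
  exact: (diagonalizes_kronmx (diagonalizes_burau_snm _ _ (zP i)) dP).
move=> x gx; have wP := prim_root_exprz (zP i) (copm i).
have iS : i \notin [set:: l] by rewrite inE.
have gxq := generic_mul_expz (m i) q0 gx.
(* Multiplying by the nonzero value at [x q^m] brings both sides to the form of the two
   recursions. *)
apply: (mulIf (tprod_neq0 m [set:: l] n0 gxq)).
rewrite set_cons (tprod_setU1 m n0 q0 gx iS _ wP); last first.
  by move=> j jl; apply: copn; apply: contraNneq iS => <-.
have gw a : generic (f qK) (x * f qK ^ m i * (z i ^ m i) ^+ a).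
  apply: (generic_mul_unity_root (n0 i)) gxq.
  by rewrite exprAC (prim_expr_order wP) expr1n.
under [in RHS]eq_bigr do rewrite -dE //.
rewrite -!dE // -(prod_burau_eig _ _ _ _ (fun y => \prod_b (1 - y * d b))) //.
congr (_ * _).
rewrite -(big_kron _ (fun a b => 1 - x * burau_eig (f qK) (z i) a ^ m i * d b)).
by apply: eq_bigr => b _; rewrite mulrA.
Qed.

Lemma zeta_snmE (L : fieldType) (f : {rmorphism K -> L}) n (m : int) (z : L) :
  n.-primitive_root z -> coprime n `|m| ->
  f (zeta_snm n m) =
    ((1 - f sK) * (1 - (f sK * f qK ^ m) ^+ n) / (1 - f sK * f qK ^ m))^-1.
Proof.
move=> zP cop; rewrite /zeta_snm fmorphV -det_map_mx; congr (_^-1).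
rewrite map_mxB map_mx1 map_mxZ.
rewrite (diagonalizes_det1B _ (diagonalizes_burau_snm _ _ zP)).
have u0 : 1 - f sK * f qK ^ m != 0.
  by rewrite subr_eq0 eq_sym -[f sK * _]expr1; apply: generic_sK.
apply: (mulIf u0); rewrite divfK //.
rewrite (prod_burau_eig _ _ _ _ (fun y => 1 - y)) ?(prim_order_gt0 zP) //.
by rewrite prod_1B_prim_root // prim_root_exprz.
Qed.

(** The extra ratio [(1 - x) / u J] does not depend on [I], so its alternating product over [I]
    inside a nonempty [J] is 1; for empty [J] the ratio itself is 1. *)
Lemma tprod_zeta (F : fieldType) (q : F) (T : finType) (n : T -> nat) (m : T -> int)
    (x : F) : (0 < #|T|)%N -> (forall i, 0 < n i)%N -> generic q x ->
  tprod q n m [set: T] x =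
  \prod_(I : {set T} | I != set0) \prod_(J : {set T} | I \subset J)
    sign_expz ((1 - x) * (1 - (x * q ^ (\sum_(j in J) m j)) ^+ (\prod_(i in I) n i)%N)
                 / (1 - x * q ^ (\sum_(j in J) m j))) (#|J| - #|I|).
Proof.
move=> T0 n0 gx; pose u (J : {set T}) := 1 - x * q ^ (\sum_(j in J) m j).
pose h (I J : {set T}) := sign_expz
  ((1 - x) * (1 - (x * q ^ (\sum_(j in J) m j)) ^+ (\prod_(i in I) n i)%N) / u J)
  (#|J| - #|I|).
rewrite -[RHS]/(\prod_(I | I != set0) \prod_(J : {set T} | I \subset J) h I J).
have u0 J : u J != 0 by rewrite subr_eq0 eq_sym -[x * _]expr1; apply: gx.
have x0 : 1 - x != 0 by have := u0 set0; rewrite /u big_set0 expr0z mulr1.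
have uJ (J : {set T}) :
    \prod_(I : {set T} | I \subset J) sign_expz ((1 - x) / u J) (#|J| - #|I|) = 1.
  have [->|J0] := eqVneq J set0.
    rewrite /u big_set0 expr0z mulr1 divff // big1 // => I _.
    by rewrite /sign_expz exp1rz.
  by rewrite prod_subset_sign_expz_sub // mulf_neq0 ?invr_eq0.
(* Multiplying by uJ replaces every factor of tprod by the corresponding [h I J];
   the [h set0 J] then multiply to 1 over all J. *)
transitivity (\prod_(J : {set T}) \prod_(I : {set T} | I \subset J) h I J).
  rewrite /tprod (eq_bigl predT) => [|J]; last by rewrite subsetT.
  apply: eq_bigr => J _; rewrite -[LHS]mulr1 -[X in _ * X](uJ J) -big_split.
  by apply: eq_bigr => I _; rewrite /= /h -sign_expzM mulrCA mulrA.
rewrite (exchange_big_dep predT) //= (bigD1 set0) //= -[RHS]mul1r; congr (_ * _).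
rewrite -[RHS](@prod_subset_sign_expz _ _ [set: T] (1 - x)) //; last first.
  by rewrite -card_gt0 cardsT.
apply: eq_big => J; rewrite ?sub0set ?subsetT // => _.
(* For empty [I] the exponent is 1, so [u J] cancels and [1 - x] remains. *)
by rewrite /h big_set0 expr1 cards0 subn0 -/(u J) mulfK.
Qed.

Unset Implicit Arguments. Set Strict Implicit. Set Printing Implicit Defensive.

Theorem theorem3p3 (r : nat) (n : 'I_r -> nat) (m : 'I_r -> int) :
  (0 < r)%N ->
  (forall i, (2 <= n i)%N) ->
  (forall i j, i != j -> coprime (n i) (n j)) ->
  (forall I : {set 'I_r}, I != set0 ->
     coprime (\prod_(i in I) n i)%N (absz (\sum_(i in I) m i))) ->
  Zq [seq (n i, m i) | i <- enum 'I_r] =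
  \prod_(I : {set 'I_r} | I != set0)
    \prod_(J : {set 'I_r} | I \subset J)
      zeta_snm (\prod_(i in I) n i)%N (\sum_(j in J) m j)
        ^ ((-1) ^+ (#|J| - #|I|) : int).
Proof.
move=> r0 n2 copn copm; have n0 i : (0 < n i)%N by apply: ltnW (n2 i).
pose N (I : {set 'I_r}) := (\prod_(i in I) n i)%N.
have N0 I : (0 < N I)%N by apply: prodn_cond_gt0 => i _.
have NS (I J : {set 'I_r}) : I \subset J -> (N I %| N J)%N.
  by move=> IJ; rewrite [N J](big_setID I) /= (setIidPr IJ) dvdn_mulr.
(* One primitive root whose order is the product of all [n i] yields, by its powers, those of every
   order [N I]. *)
have [L [f [z zP]]] := K_prim_root_extension (N0 setT).
have zN I : (N I).-primitive_root (z ^+ (N setT %/ N I)).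
  by apply: dvdn_prim_root => //; apply: NS; apply: subsetT.
have N1 i : N [set i] = n i by rewrite /N big_set1.
have zn i : (n i).-primitive_root (z ^+ (N setT %/ n i)) by rewrite -N1.
have cop1 i : coprime (n i) `|m i|.
  by have := copm [set i]; rewrite !big_set1; apply; apply/set0Pn; exists i; rewrite set11.
have [d dP dE] := diagonalizes_kron_burau f zn cop1 copn (enum_uniq 'I_r).
apply: (fmorph_inj f); rewrite /Zq fmorphV -det_map_mx.
rewrite map_mxB map_mx1 map_mxZ (diagonalizes_det1B _ dP) dE; last exact: generic_sK.
have -> : [set:: enum 'I_r] = setT by apply/setP => i; rewrite !inE mem_enum.
rewrite tprod_zeta ?card_ord //; last exact: generic_sK.
rewrite -prodfV rmorph_prod; apply: eq_bigr => I I0.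
rewrite -prodfV rmorph_prod; apply: eq_bigr => J IJ.
rewrite fmorphXz (zeta_snmE _ (zN I)) ?expfV //.
(* The coprimality assumption is applied to [J], and passes to [N I] because [N I] divides [N J]. *)
have J0 : J != set0 by apply: contraNneq I0 => J0; rewrite -subset0 -J0.
exact: coprime_dvdl (NS I J IJ) (copm J J0).
Qed.
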